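(* Let $(X,\mathcal{A})$ be a measurable space. Then $(X,\mathcal{A})$ is a $T$-measurable space if and only if for every prime ideal $P$ in $M(X)$, $\left|\bigcap_{f\in P}Z(f)\right|\le 1$.
   Context: A measurable space $(X,\mathcal{A})$ is a nonempty set $X$ with a $\sigma$-algebra $\mathcal{A}$ of subsets of $X$. $M(X)$ is the commutative ring (pointwise operations) of all functions $f:X\to\mathbb{R}$ with $f^{-1}(V)\in\mathcal{A}$ for every open $V\subseteq\mathbb{R}$. For $f\in M(X)$, $Z(f)=\{x\in X: f(x)=0\}$. A measurable space is $T$-measurable if whenever $x,y$ are distinct points of it, there is a measurable set containing one of them and not the other. *)

(* Defs.v *)
From HB Require Import structures.
From mathcomp Require Export all_boot all_order all_algebra.
From mathcomp Require Export all_classical all_reals all_analysis.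
From mathcomp Require Export measurable_realfun.
Set Implicit Arguments.
Unset Strict Implicit.
Unset Printing Implicit Defensive.
Import Order.TTheory GRing.Theory Num.Theory.
Import numFieldNormedType.Exports.
Local Open Scope classical_set_scope.
Local Open Scope ring_scope.

Definition T_measurable (d : measure_display) (X : measurableType d) : Prop :=
  forall x y : X, x <> y ->
    exists A : set X, measurable A /\ ((A x /\ ~ A y) \/ (A y /\ ~ A x)).

(* The ring M(X) is {mfun X >-> R} with the library's pointwise ring structure.
   There R carries its Borel sigma-algebra; the following lemma identifies its
   elements as the functions whose preimages of open sets are measurable.
   Prime ideals of M(X) are inhabitants of prime_idealr {mfun X >-> R}: they are
   proper (1 \notin P), and since every proposition has a boolean reflection
   classically, quantifying over boolean predicates loses no prime ideal.
   X is nonempty because a measurableType is pointed. *)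
Lemma mfun_openP (R : realType) (d : measure_display) (X : measurableType d)
    (f : X -> R) :
  measurable_fun setT f <->
  (forall V : set R, open V -> measurable (f @^-1` V)).
Proof.
split=> [mf V oV|H].
  by rewrite -[X in measurable X]setTI; apply: mf => //; exact: open_measurable.
apply: (measurability _ (RGenOpens.measurableE R)) => _ [V [a [b ->]] <-].
by rewrite setTI; apply: H; exact: interval_open.
Qed.

Definition zero_set (R : realType) (d : measure_display) (X : measurableType d)
    (f : {mfun X >-> R}) : set X := [set x | f x = 0].

(* Main.v *)
Require Import Defs.
From HB Require Import structures.
From mathcomp Require Import all_boot all_order all_algebra.
From mathcomp Require Import all_classical all_reals all_analysis.
Local Open Scope classical_set_scope.
Local Open Scope ring_scope.
Local Open Scope card_scope.
Import GRing.Theory.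

(** Both conditions say that distinct points are separated by measurable sets.

    For a measurable set [A], the indicators of [A] and of its complement
    multiply to [0], so every prime ideal contains one of them. At a common zero
    of the ideal that indicator vanishes, so all common zeros lie on the same
    side of [A] ([prime_ideal_zeros_inseparable]). In a T-measurable space a
    prime ideal therefore has at most one common zero.

    Conversely, the functions vanishing at a point [x] form a prime ideal, the
    kernel of evaluation at [x] into the field of reals. If no measurable set
    separates [x] from [y], then no measurable function does either
    ([mfun_eq_inseparable]), so [y] is also a common zero of that ideal, and the
    bound on the number of common zeros forces [x = y]. *)

Lemma card_leI1P (T : Type) (A : set T) : A #<= `I_1 <-> is_subset1 A.
Proof.
split=> [/pcard_leP[f] x y Ax Ay|A1].
  have f0 z : A z -> f z = 0%N.
    by move=> /(@funS _ _ _ _ f) /=; rewrite ltnS leqn0 => /eqP.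
  apply: (@inj _ _ A f x y); rewrite ?inE //.
  exact: etrans (f0 x Ax) (esym (f0 y Ay)).
have [->//|/set0P[x Ax]] := eqVneq A set0.
have /subset_card_le/card_le_trans : A `<=` [set x] by move=> y /A1; exact.
by apply; have := @card_set1 T x; rewrite card_eq_le => /andP[].
Qed.

Section measurable_function_ring.
Context (R : realType) (d : measure_display) (X : measurableType d).

Definition inseparable (x y : X) :=
  forall A : set X, measurable A -> A x <-> A y.

Lemma T_measurableP :
  T_measurable X <-> (forall x y, inseparable x y -> x = y).
Proof.
split=> [TX x y xy|TX x y xy].
  apply: contrapT => /TX[A [mA]].
  by have [] := xy A mA; tauto.
apply: contrapT => nA; apply: xy; apply: TX => A mA.
split=> [Ax|Ay]; apply: contrapT => nA'; apply: nA; exists A; tauto.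
Qed.

(** The fibre of [f] over [f x] is a measurable set containing [x]. *)
Lemma mfun_eq_inseparable (f : {mfun X >-> R}) (x y : X) :
  inseparable x y -> f x = f y.
Proof.
move=> xy; apply/esym.
have mA : measurable (f @^-1` [set f x]).
  by rewrite -[X in measurable X]setTI; apply: measurable_funP.
by have /(_ erefl) := (xy _ mA).1.
Qed.

(** One of the complementary idempotents [\1_A] and [\1_(~` A)] lies in [P];
    vanishing at [x] and [y], it puts both points outside its own set. *)
Lemma prime_ideal_zeros_inseparable (P : prime_idealr {mfun X >-> R})
    (x y : X) :
  (forall f, f \in P -> f x = 0) -> (forall f, f \in P -> f y = 0) ->
  inseparable x y.
Proof.
move=> Px Py A mA.
pose e : {mfun X >-> R} := indic_mfun A mA.
pose e' : {mfun X >-> R} := indic_mfun (~` A) (measurableC mA).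
have ee' : e * e' \in P.
  suff -> : e * e' = 0 by exact: rpred0.
  apply/mfuneqP => z; rewrite -[LHS]/(e z * e' z) /= !mindicE.
  by rewrite classical_sets.in_setC; case: (z \in A); rewrite ?mulr0 ?mul0r.
have zeroE (B : set X) mB z : (indic_mfun B mB : {mfun X >-> R}) z = 0 -> ~ B z.
  by rewrite /= mindicE => + /mem_set Bz; rewrite Bz => /eqP; rewrite oner_eq0.
move: ee'; rewrite prime_idealrM => /orP[eP|eP].
- by have := zeroE _ _ _ (Px _ eP); have := zeroE _ _ _ (Py _ eP); tauto.
- have /contrapT := zeroE _ _ _ (Px _ eP).
  by have /contrapT := zeroE _ _ _ (Py _ eP); tauto.
Qed.

Definition vanishing_at (x : X) (f : {mfun X >-> R}) : bool := f x == 0.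

Lemma vanishing_at_idealr_closed (x : X) : idealr_closed (vanishing_at x).
Proof.
split=> [||a u v /eqP ux /eqP vx].
- exact/eqP.
- exact: oner_neq0.
- by apply/eqP; rewrite -[LHS]/(a x * u x + v x) ux vx mulr0 addr0.
Qed.

Lemma vanishing_at_prime_closed (x : X) : prime_idealr_closed (vanishing_at x).
Proof. by move=> u v; rewrite -[_ \in _]/(u x * v x == 0) mulf_eq0. Qed.

HB.instance Definition _ (x : X) :=
  isIdealr.Build _ (vanishing_at x) (vanishing_at_idealr_closed x).
HB.instance Definition _ (x : X) :=
  isPrimeIdealrClosed.Build _ (vanishing_at x)
    (vanishing_at_prime_closed x).

End measurable_function_ring.

Theorem proposition20 (R : realType) (d : measure_display)
    (X : measurableType d) :
  T_measurable X <->
  (forall P : prime_idealr {mfun X >-> R},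
     \bigcap_(f in [set f | f \in P]) zero_set f #<= `I_1).
Proof.
rewrite T_measurableP; split=> [TX P|PX x y xy].
  apply/card_leI1P => x y Px Py.
  by apply: TX; apply: (prime_ideal_zeros_inseparable R _ _ P).
have /card_leI1P := PX (vanishing_at R d X x : prime_idealr _).
apply=> f /eqP fx //; rewrite /zero_set /=.
by rewrite -(mfun_eq_inseparable R d X f x y xy).
Qed.
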